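(* Fix an integer $n \geq 1$ and a subgroup $G \leq S_2 \wr S_n$ of the group of signed permutations, acting by signed permutations on commuting variables $u_1,\dots,u_n$ and on commuting variables $v_1,\dots,v_n$. Let $\psi = \sum_{\chi \in \widehat{G}_{\mathbb{C}}} a_\chi \chi$ be any complex class function of $G$, with $a_\chi \in \mathbb{C}$. Then for an arbitrary commutative $R_\psi$-algebra $R$ and any formal power series $f(t) = \sum_{M \ge 0} f_M t^M \in R[[t]]$ (with $t$ an indeterminate), \[ |G|\, E_\psi^{\mathbf{u}} \cdot \prod_{i=1}^n f(t u_i v_i) = |G|\, E_{\overline{\psi}}^{\mathbf{v}} \cdot \prod_{i=1}^n f(t u_i v_i) = \sum_{\chi \in \widehat{G}_{\mathbb{C}}} a_\chi \sum_{\mathbf{m} \in \mathbb{Z}_{\geq 0}^n} t^{|\mathbf{m}|} f_{\mathbf{m}} \cdot E_\chi^{\mathbf{u}}(\mathbf{u}^{\mathbf{m}}) \cdot E_{\overline{\chi}}^{\mathbf{v}}(\mathbf{v}^{\mathbf{m}}), \] where, for $\mathbf{m} = (m_1,\dots,m_n)$, $|\mathbf{m}| = m_1+\cdots+m_n$, $f_{\mathbf{m}} := \prod_i f_{m_i}$, $\mathbf{u}^{\mathbf{m}} := \prod_i u_i^{m_i}$ and $\mathbf{v}^{\mathbf{m}} := \prod_i v_i^{m_i}$.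
   Context: All the variables $u_1,\dots,u_n,v_1,\dots,v_n$ commute with one another; the identity is in $R[u_1,\dots,u_n,v_1,\dots,v_n][[t]]$, and operators act coefficientwise in $t$. $\widehat{G}_{\mathbb{C}}$ is the set of irreducible complex characters of the finite group $G$. $R_\psi \subset \mathbb{C}$ is the unital subring generated over $\mathbb{Z}$ by all coefficients $a_\chi$ and all values $\chi(g)$ with $g \in G$ and $\chi \in \widehat{G}_{\mathbb{C}}$, $a_\chi \neq 0$. Sums over $\chi$ weighted by $a_\chi$ involve only those $\chi$ with $a_\chi \neq 0$. Each $g \in S_2 \wr S_n$ is written $g = D_g \sigma_g$, with $D_g$ diagonal with diagonal entries $(D_g)_i \in \{\pm 1\}$ and $\sigma_g \in S_n$ a permutation (matrix). $g^{\mathbf{u}}$ is the $R$-algebra automorphism of $R[u_1,\dots,u_n,v_1,\dots,v_n]$ with $u_i \mapsto (D_g)_{\sigma_g(i)}\, u_{\sigma_g(i)}$ and fixing every $v_j$; $g^{\mathbf{v}}$ is defined in the same way on the $v$-variables, fixing every $u_i$. For $\chi \in \widehat{G}_{\mathbb{C}}$, $E_\chi := \chi(1)\sum_{g\in G}\chi(g) g^{-1}$, and $E_\chi^{\mathbf{u}}$, $E_\chi^{\mathbf{v}}$ denote its actions through $g \mapsto g^{\mathbf{u}}$ and $g\mapsto g^{\mathbf{v}}$ respectively. $\overline{\chi}$ is the complex conjugate character of $\chi$. Finally $E_\psi^{\mathbf{u}} := \sum_\chi a_\chi E_\chi^{\mathbf{u}}$, $\overline{\psi} := \sum_\chi a_\chi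 \overline{\chi}$ (with $a_\chi$, not its complex conjugate), and $E_{\overline{\psi}}^{\mathbf{v}} := \sum_\chi a_\chi E_{\overline{\chi}}^{\mathbf{v}}$. *)

(* Defs.v *)
From HB Require Import structures.
From mathcomp Require Import all_boot all_order all_algebra all_fingroup.
From mathcomp Require Import all_field all_character.
From mathcomp Require Import boolp reals complex mpoly.

Set Implicit Arguments.
Unset Strict Implicit.
Unset Printing Implicit Defensive.

Import GRing.Theory Num.Theory.

Local Open Scope ring_scope.

(* The signed permutation D sigma, where D is the diagonal matrix with j-th   *)
(* entry (-1) ^+ sp_sgn g j, and sigma = sp_perm g sends the i-th basis       *)
(* vector to the (sigma i)-th one.                                            *)
Record signed_perm (n : nat) :=
  SignedPerm { sp_sgn : {ffun 'I_n -> bool}; sp_perm : 'S_n }.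

Section SignedPermGroup.
Variable n : nat.
Implicit Types g h : signed_perm n.

Definition sp_pair g := (sp_sgn g, sp_perm g).
Definition pair_sp (p : {ffun 'I_n -> bool} * 'S_n) := SignedPerm p.1 p.2.
Lemma sp_pairK : cancel sp_pair pair_sp. Proof. by case. Qed.

HB.instance Definition _ := Equality.copy (signed_perm n) (can_type sp_pairK).
HB.instance Definition _ := Choice.copy (signed_perm n) (can_type sp_pairK).
HB.instance Definition _ := Countable.copy (signed_perm n) (can_type sp_pairK).
HB.instance Definition _ := Finite.copy (signed_perm n) (can_type sp_pairK).

(* (D sigma) (D' sigma') = (D (sigma D' sigma^-1)) (sigma o sigma'); the      *)
(* product s * t of 'S_n is composition in the opposite order, t o s.         *)
Definition sp_mul g h := SignedPerm
  [ffun j => sp_sgn g j (+) sp_sgn h ((sp_perm g)^-1%g j)]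
  (sp_perm h * sp_perm g)%g.
Definition sp_one := SignedPerm [ffun => false] (1%g : 'S_n).
Definition sp_inv g := SignedPerm
  [ffun j => sp_sgn g (sp_perm g j)] (sp_perm g)^-1%g.

Lemma sp_eq g h :
  sp_sgn g =1 sp_sgn h -> sp_perm g =1 sp_perm h -> g = h.
Proof. by case: g h => [d s] [d' s'] /= /ffunP-> /permP->. Qed.

Lemma sp_mulA : associative sp_mul.
Proof.
move=> g h k; apply: sp_eq => i; rewrite !(ffunE, permM) //=.
by rewrite invMg permM addbA.
Qed.

Lemma sp_mul1 : left_id sp_one sp_mul.
Proof.
by move=> g; apply: sp_eq => i; rewrite /= ?mulg1 // !ffunE invg1 perm1.
Qed.

Lemma sp_mulV : left_inverse sp_one sp_inv sp_mul.
Proof.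
move=> g; apply: sp_eq => i; rewrite /= ?mulgV // !ffunE invgK addbb //.
Qed.

HB.instance Definition _ :=
  Finite_isGroup.Build (signed_perm n) sp_mulA sp_mul1 sp_mulV.

Definition sp_mx g : 'M[int]_n :=
  \matrix_(j, i) if j == sp_perm g i then (-1) ^+ sp_sgn g j else 0.

Lemma sp_mxM g h : sp_mx (g * h)%g = sp_mx g *m sp_mx h.
Proof.
apply/matrixP=> j i; rewrite !mxE (bigD1 (sp_perm h i)) //= big1 => [|k].
  rewrite !mxE eqxx addr0 permM ffunE; case: eqP => [->|_]; last by rewrite mul0r.
  by rewrite signr_addb permK.
by rewrite !mxE => /negPf->; rewrite mulr0.
Qed.

End SignedPermGroup.

Section Characters.
Variables (K : realType) (gT : finGroupType) (G : {group gT}).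

(* The index set of the irreducible complex characters: the Wedderburn        *)
(* components of the regular representation over K[i], one for each           *)
(* isomorphism class of irreducible representations.                          *)
Definition Irr : irrType (K[i]) G := DecSocleType (regular_repr (K[i]) G).

Definition irr_chi (x : Irr) (g : gT) : K[i] := \tr (irr_repr x g).

Definition conj_char (phi : gT -> K[i]) (g : gT) : K[i] := (phi g)^*.

Lemma mxtrace_exp_conj (C : numClosedFieldType) d (A : 'M[C]_d.+1) k :
  A ^+ k.+1 = 1 -> \tr (A ^+ k) = (\tr A)^*.
Proof.
move=> Ak1; have /diagonalizableP[P Punit]: exists2 rs : seq C,
    uniq rs & mxminpoly A %| \prod_(x <- rs) ('X - x%:P).
  have := @separable_Xn_sub_1 C k.+1; rewrite pnatr_eq0 => /(_ isT).
  have [rs] := closed_field_poly_normal ('X^(k.+1) - 1 : {poly C}).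
  rewrite lead_coefDl ?size_polyXn ?size_polyN ?size_poly1 // lead_coefXn scale1r.
  move=> defX; rewrite defX separable_prod_XsubC => Urs.
  exists rs => //; rewrite -defX; apply: mxminpoly_min.
  by rewrite rmorphB rmorphXn rmorph1 /= horner_mx_X Ak1 subrr.
move=> /(similar_diagLR Punit)[e]; rewrite conjumx ?unitmx_inv // invmxK.
set D := diag_mx e => defA.
have powA m : A ^+ m = invmx P *m diag_mx (\row_i e 0 i ^+ m) *m P.
  elim: m => [|m IHm].
    rewrite expr0 (_ : diag_mx _ = 1%:M) ?mulmx1 ?mulVmx //.
    by apply/matrixP=> i j; rewrite !mxE expr0.
  rewrite exprS IHm defA -[LHS]/(_ *m _) !mulmxA mulmxK //; congr (_ *m _).
  rewrite -!mulmxA mulmx_diag; congr (_ *m diag_mx _).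
  by apply/rowP=> i; rewrite !mxE exprS.
have trA m : \tr (A ^+ m) = \sum_i e 0 i ^+ m.
  rewrite powA mxtrace_mulC mulmxA mulmxV // mul1mx mxtrace_diag.
  by apply: eq_bigr => i _; rewrite mxE.
have e1 i : e 0 i ^+ k.+1 = 1.
  have := congr1 (fun M => P *m M *m invmx P) Ak1.
  rewrite powA !mulmxA mulmxV // mul1mx mulmxK // -[1]/(1%:M) mulmx1 mulmxV //.
  by move=> /matrixP/(_ i i); rewrite !mxE eqxx.
rewrite trA -[A in RHS]expr1 trA rmorph_sum; apply: eq_bigr => i _ /=.
have ne1: `|e 0 i| = 1.
  by apply/eqP; rewrite -(@pexpr_eq1 _ _ k.+1) // -normrX e1 normr1.
have e_neq0: e 0 i != 0 by rewrite -normr_eq0 ne1 oner_eq0.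
rewrite expr1 -[RHS]mul1r -{1}(e1 i) exprSr -mulrA -normCK ne1 expr1n mulr1 //.
Qed.

Lemma irr_chi_inv (x : Irr) g :
  g \in G -> irr_chi x g^-1%g = conj_char (irr_chi x) g.
Proof.
rewrite /conj_char /irr_chi; move: (irr_repr x).
case: (irr_degree x) => [|d] rG Gg.
  by rewrite /mxtrace !big_ord0 rmorph0.
have gV: (g^-1 = g ^+ #[g]%g.-1)%g by rewrite invg_expg.
rewrite gV repr_mxX //; apply: mxtrace_exp_conj.
by rewrite -repr_mxX // prednK // expg_order repr_mx1.
Qed.

End Characters.

Section SubringGen.
Variables (C : comNzRingType) (S : C -> Prop).

Definition subring_gen : {pred C} := fun x =>
  `[< forall A : {pred C},
        GRing.subring_closed A -> (forall y, S y -> y \in A) -> x \in A >].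

Lemma subring_gen_closed : GRing.subring_closed subring_gen.
Proof.
split=> [|x y /asboolP xS /asboolP yS|x y /asboolP xS /asboolP yS];
  apply/asboolP => A clA SA; have [A1 AB AM] := clA => //.
  by apply: AB; [apply: xS | apply: yS].
by apply: AM; [apply: xS | apply: yS].
Qed.

HB.instance Definition _ :=
  GRing.isSubringClosed.Build C subring_gen subring_gen_closed.

Lemma mem_subring_gen y : S y -> y \in subring_gen.
Proof. by move=> Sy; apply/asboolP => A _; apply. Qed.

Record subring_of := SubringOf { subring_val :> C; _ : subring_val \in subring_gen }.
HB.instance Definition _ := [isSub for subring_val].
HB.instance Definition _ := [Choice of subring_of by <:].
HB.instance Definition _ := [SubChoice_isSubComNzRing of subring_of by <:].

End SubringGen.


Section Rpsi.
Variables (K : realType) (gT : finGroupType) (G : {group gT}).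
Variable a : Irr K G -> K[i].

Definition Rpsi_gen (y : K[i]) : Prop :=
  exists x : Irr K G,
    a x != 0 /\ (y = a x \/ exists2 g, g \in G & y = irr_chi x g).

Definition Rpsi : comNzRingType := subring_of Rpsi_gen.

(* Only used on elements of R_psi (see the mem_Rpsi lemmas), where it is the  *)
(* identity; the default value 0 is irrelevant.                               *)
Definition to_Rpsi (y : K[i]) : Rpsi := insubd (0 : subring_of Rpsi_gen) y.

Lemma to_RpsiK y :
  y \in subring_gen Rpsi_gen -> subring_val (to_Rpsi y) = y.
Proof. exact: insubdK. Qed.

Lemma mem_Rpsi_coef x : a x != 0 -> a x \in subring_gen Rpsi_gen.
Proof. by move=> ax; apply: mem_subring_gen; exists x; split=> //; left. Qed.

Lemma mem_Rpsi_char x g :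
  a x != 0 -> g \in G -> irr_chi x g \in subring_gen Rpsi_gen.
Proof.
by move=> ax Gg; apply: mem_subring_gen; exists x; split=> //; right; exists g.
Qed.

Lemma mem_Rpsi_conj_char x g :
  a x != 0 -> g \in G -> conj_char (irr_chi x) g \in subring_gen Rpsi_gen.
Proof.
by move=> ax Gg; rewrite -irr_chi_inv // mem_Rpsi_char // groupV.
Qed.

End Rpsi.

(* Formal power series in t over S, as coefficient sequences.                 *)
Definition fps (S : Type) := nat -> S.

Section PowerSeries.
Variable S : comNzRingType.

Definition fps_one : fps S := fun N => (N == 0%N)%:R.

Definition fps_mul (p q : fps S) : fps S :=
  fun N => \sum_(k < N.+1) p k * q (N - k)%N.

Definition fps_map (phi : S -> S) (p : fps S) : fps S := fun N => phi (p N).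

(* \sum_m t^|m| (c m), over all multi-indices m of length n.                  *)
Definition fps_msum n (c : 'X_{1..n} -> S) : fps S :=
  fun N => \sum_(m : 'X_{1..n < N.+1} | mdeg m == N) c m.

End PowerSeries.

(* f(t p) *)
Definition fps_eval_t (R : comNzRingType) (S : algType R) (f : fps R) (p : S) :
  fps S := fun M => f M *: p ^+ M.

Section Action.
Variables (n : nat) (R : comNzRingType).

(* R[u_1, ..., u_n, v_1, ..., v_n] is {mpoly R[n + n]}.                       *)
Definition uvar (i : 'I_n) : {mpoly R[n + n]} := 'X_(lshift n i).
Definition vvar (i : 'I_n) : {mpoly R[n + n]} := 'X_(rshift n i).

Definition umonom (m : 'X_{1..n}) : {mpoly R[n + n]} := \prod_i uvar i ^+ m i.
Definition vmonom (m : 'X_{1..n}) : {mpoly R[n + n]} := \prod_i vvar i ^+ m i.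

(* The R-algebra endomorphism u_i |-> U i, v_i |-> V i.                       *)
Definition uvsubst (U V : 'I_n -> {mpoly R[n + n]}) (p : {mpoly R[n + n]}) :
    {mpoly R[n + n]} :=
  p \mPo [tuple match split k with inl i => U i | inr i => V i end | k < n + n].

Definition uact (g : signed_perm n) : {mpoly R[n + n]} -> {mpoly R[n + n]} :=
  uvsubst (fun i => (-1) ^+ sp_sgn g (sp_perm g i) *: uvar (sp_perm g i)) vvar.

Definition vact (g : signed_perm n) : {mpoly R[n + n]} -> {mpoly R[n + n]} :=
  uvsubst uvar (fun i => (-1) ^+ sp_sgn g (sp_perm g i) *: vvar (sp_perm g i)).

End Action.

Section Operators.
Variables (K : realType) (n : nat) (G : {group signed_perm n}).
Variables (a : Irr K G -> K[i]) (R : comAlgType (Rpsi a)).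

Definition to_alg (y : K[i]) : R := (to_Rpsi a y)%:A.

Definition fprod_tuv (f : fps R) : fps {mpoly R[n + n]} :=
  \big[@fps_mul _/@fps_one _]_(i < n) fps_eval_t f (uvar R i * vvar R i).

(* The action of E_phi = phi(1) \sum_(g in G) phi(g) g^-1 through act.         *)
Definition Eop (act : signed_perm n -> {mpoly R[n + n]} -> {mpoly R[n + n]})
    (phi : signed_perm n -> K[i]) (p : {mpoly R[n + n]}) : {mpoly R[n + n]} :=
  to_alg (phi 1%g) *: \sum_(g in G) to_alg (phi g) *: act g^-1%g p.

Definition Eu := Eop (@uact n R).
Definition Ev := Eop (@vact n R).

Definition Eu_psi (p : {mpoly R[n + n]}) : {mpoly R[n + n]} :=
  \sum_(x : Irr K G | a x != 0) to_alg (a x) *: Eu (irr_chi x) p.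

(* psibar = \sum_x a_x conj(chi_x): the coefficients are not conjugated.       *)
Definition Ev_psibar (p : {mpoly R[n + n]}) : {mpoly R[n + n]} :=
  \sum_(x : Irr K G | a x != 0) to_alg (a x) *: Ev (conj_char (irr_chi x)) p.

End Operators.

(* Main.v *)
(* By linearity it suffices to treat one character chi. Write P for the product *)
(* of the f(t u_i v_i). The substitution u_i v_i |-> g(u_i) v_i is, up to       *)
(* reordering the factors, u_j v_j |-> u_j g^-1(v_j), so g^u P = (g^-1)^v P and *)
(* hence E_chi^u P = E_chibar^v P, because chi(g^-1) is the conjugate of        *)
(* chi(g). Schur's lemma gives E_chi E_chi = |G| E_chi, so                      *)
(* |G| E_chi^u P = E_chi^u E_chibar^v P, which is expanded by writing P as the  *)
(* sum of the f_m u^m v^m, the two operators acting on separate variables.      *)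
Require Import Defs.
From HB Require Import structures.
From mathcomp Require Import all_boot all_order all_algebra all_fingroup.
From mathcomp Require Import all_field all_character.
From mathcomp Require Import boolp reals complex mpoly.

Import GRing.Theory Num.Theory.

Local Open Scope ring_scope.

(** The first equality is the symmetry [Eu_fprod]: every factor of the product is a series in u_i
    v_i, so by [uact_uv] the action of g on the u's can be traded for that of its inverse on the
    v's, and inversion conjugates chi. The second rests on [Eu_Eu]: writing |G| E_chi as E_chi E_chi
    leaves one copy to keep on the u's and one to trade to the v's, and [Eu_Ev_monom] splits the
    result on each monomial of [coef_fprod]. The character identities are proved over [K[i]] and
    reach R through R_psi, on which [to_alg] respects sums and products. *)

(** * Convolution of an irreducible character with itself *)

Section CharacterConvolution.
Context {C : numClosedFieldType} {gT : finGroupType} {G : {group gT}}.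
Context {d : nat} {rG : mx_representation C G d}.
Hypothesis irrG : mx_irreducible rG.

(* Conjugation-averaging A commutes with G, so Schur's lemma makes it scalar.   *)
Lemma sum_conj_repr (A : 'M[C]_d) :
  d%:R *: (\sum_(g in G) rG g *m A *m rG g^-1%g) = (#|G|%:R * \tr A)%:M.
Proof.
set T := \sum_(g in G) _.
have absG : mx_absolutely_irreducible rG by apply: group_closure_closed_field.
have /(mx_abs_irr_cent_scalar absG)/is_scalar_mxP[c defT] : centgmx rG T.
  apply/centgmxP => h Gh; rewrite mulmx_suml mulmx_sumr.
  rewrite (reindex_inj (mulgI h)); apply: eq_big => [g|g]; rewrite groupMl // => Gg.
  rewrite invMg !repr_mxM ?groupV // !mulmxA -[LHS]mulmxA.
  by rewrite -(repr_mxM rG (groupVr Gh) Gh) mulVg repr_mx1 mulmx1.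
have trT : \tr T = #|G|%:R * \tr A.
  rewrite raddf_sum /= mulr_natl -sumr_const; apply: eq_bigr => g Gg.
  by rewrite mxtrace_mulC mulmxA -repr_mxM ?groupV // mulVg repr_mx1 mul1mx.
by rewrite -trT defT mxtrace_scalar scale_scalar_mx mulr_natl.
Qed.

(** The (i,k) entry of A E_ij B is A_ii B_jk, so summing it over i produces tr(A) B_jk. Averaging
    each matrix unit E_ij gives a scalar matrix that vanishes unless i = j. *)
Lemma sum_trace_repr :
  d%:R *: (\sum_(g in G) \tr (rG g) *: rG g^-1%g) = #|G|%:R%:M.
Proof.
apply/matrixP => j k.
have -> : (d%:R *: (\sum_(g in G) \tr (rG g) *: rG g^-1%g)) j k =
    \sum_i (d%:R *: (\sum_(g in G) rG g *m delta_mx i j *m rG g^-1%g)) i k.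
  under [RHS]eq_bigr do rewrite mxE summxE.
  rewrite -mulr_sumr exchange_big mxE summxE; congr (_ * _).
  apply: eq_bigr => g _; rewrite mxE mulr_suml; apply: eq_bigr => i _.
  rewrite -mulmxA mxE (bigD1 i) //= big1 ?addr0 => [|l l_i].
    rewrite mxE (bigD1 j) //= big1 ?addr0 => [|l l_j].
      by rewrite mxE !eqxx mul1r.
    by rewrite mxE (negPf l_j) andbF mul0r.
  by rewrite mxE big1 ?mulr0 // => m _; rewrite mxE (negPf l_i) mul0r.
under eq_bigr do rewrite sum_conj_repr mxE.
rewrite !mxE (bigD1 j) //= big1 ?addr0 => [|i i_j].
  rewrite /mxtrace (bigD1 j) //= big1 => [|l l_j].
    by rewrite mxE !eqxx addr0 mulr1.
  by rewrite mxE (negPf l_j).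
rewrite /mxtrace big1 ?mulr0 ?mul0rn // => l _.
by rewrite mxE; case: eqP => //= ->; rewrite (negPf i_j).
Qed.

(** Multiply [sum_trace_repr] by [rG k] and take traces. *)
Lemma trace_repr_conv k : k \in G ->
  d%:R * (\sum_(g in G) \tr (rG g) * \tr (rG (k * g^-1)%g)) =
  #|G|%:R * \tr (rG k).
Proof.
move=> Gk; have := congr1 (fun A => \tr (rG k *m A)) sum_trace_repr.
rewrite /= mul_mx_scalar mxtraceZ => <-.
rewrite -scalemxAr mxtraceZ mulmx_sumr raddf_sum; congr (_ * _).
apply: eq_bigr => g Gg.
by rewrite -scalemxAr /= mxtraceZ repr_mxM ?groupV.
Qed.

End CharacterConvolution.

Lemma linear_comb {R : pzRingType} {V W : lmodType R} (L : {linear V -> W})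
    (I : Type) (r : seq I) (P : pred I) (c : I -> R) (F : I -> V) :
  L (\sum_(i <- r | P i) c i *: F i) = \sum_(i <- r | P i) c i *: L (F i).
Proof. by rewrite linear_sum; apply: eq_bigr => i _; rewrite linearZ. Qed.

(** Collecting the terms of E E by the product k of the two group elements, the coefficient of
    [T k^-1] is b^2 times the convolution of c with itself at k. One b stays outside; the hypothesis
    absorbs the other. *)
Lemma group_sum_idem {R : comNzRingType} {V : lmodType R} {gT : finGroupType}
    {G : {group gT}} (T : gT -> {linear V -> V}) (c : gT -> R) (b N : R) :
  (forall g h p, T (g * h)%g p = T g (T h p)) ->
  {in G, forall k, b * (\sum_(g in G) c g * c (k * g^-1)%g) = N * c k} ->
  let E p := b *: \sum_(g in G) c g *: T g^-1%g p in
  forall p, E (E p) = N *: E p.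
Proof.
move=> TM conv E p; rewrite /E [RHS]scalerA mulrC -[RHS]scalerA.
congr (_ *: _); rewrite [RHS]scaler_sumr.
transitivity (\sum_(h in G) \sum_(k in G)
    (b * (c h * c (k * h^-1)%g)) *: T k^-1%g p).
  apply: eq_bigr => h Gh; rewrite linearZ linear_sum /= !scaler_sumr.
  rewrite [LHS](reindex_inj (mulIg h^-1%g)).
  apply: eq_big => [k|k]; rewrite groupMr ?groupV // => _.
  by rewrite [T h^-1%g _]linearZZ !scalerA -TM -invMg mulgKV mulrCA mulrA.
rewrite exchange_big; apply: eq_bigr => k Gk.
by rewrite -scaler_suml -mulr_sumr scalerA conv.
Qed.

(** * Expansion of a product of power series over multi-indices *)

Section PowerSeriesProduct.
Context {S : comNzRingType} {n : nat}.
Variable F : 'I_n -> fps S.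

(* Truncating the factors to polynomials makes the bigop lemmas available;      *)
(* fps_mul is not declared as a monoid law.                                     *)
Lemma coef_fps_prod N :
  (\big[@fps_mul S/@fps_one S]_(i < n) F i) N =
  (\prod_(i < n) \poly_(k < N.+1) F i k)`_N.
Proof.
suff H k : (k <= N)%N -> (\big[@fps_mul S/@fps_one S]_(i < n) F i) k =
    (\prod_(i < n) \poly_(k < N.+1) F i k)`_k by exact: H.
elim/big_rec2: _ k => [|i p q _ IH] k le_kN; first by rewrite coef1.
rewrite coefM; apply: eq_bigr => j _.
have le_jN : (j <= N)%N by rewrite (leq_trans _ le_kN) // -ltnS.
by rewrite coef_poly ltnS le_jN IH // (leq_trans (leq_subr _ _)).
Qed.

Lemma fps_prod_msum :
  \big[@fps_mul S/@fps_one S]_(i < n) F i =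
  fps_msum (fun m : 'X_{1..n} => \prod_(i < n) F i (m i)).
Proof.
apply/funext => N; rewrite coef_fps_prod.
under eq_bigr do rewrite poly_def.
rewrite bigA_distr_bigA coef_sum /=.
under eq_bigr => e do
  rewrite scaler_prod -expr_sum coefZ coefXn mulr_natr mulrb.
rewrite -big_mkcond /fps_msum.
(* The default [bm0] is never reached on the terms kept, whose exponents sum to N and hence stay
   below the bound. *)
pose toM (e : {ffun 'I_n -> 'I_N.+1}) : 'X_{1..n < N.+1} :=
  insubd bm0 [multinom (e i : nat) | i < n].
rewrite (reindex_onto (fun m : 'X_{1..n < N.+1} => [ffun i => inord (m i)]) toM).
  have val_inord (m : 'X_{1..n < N.+1}) i : (inord (m i) : 'I_N.+1) = m i :> nat.
    rewrite inordK //; apply: leq_ltn_trans (bmdeg m).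
    by rewrite mdegE (bigD1 i) //= leq_addr.
  apply: eq_big => [m|m _].
    rewrite (_ : toM _ = m) ?eqxx ?andbT.
      by rewrite eq_sym mdegE; under eq_bigr do rewrite ffunE val_inord.
    apply: val_inj; rewrite /toM /=; set m' := [multinom _ | _ < _].
    have -> : m' = m by apply/mnmP => i; rewrite mnmE ffunE val_inord.
    by rewrite insubdK // unfold_in bmdeg.
  by apply: eq_bigr => i _; rewrite ffunE val_inord.
move=> e /eqP degN; apply/ffunP => i; rewrite ffunE.
have ltN : (mdeg [multinom (e i : nat) | i < n] < N.+1)%N.
  by rewrite mdegE ltnS (eq_bigr _ (fun i _ => mnmE _ i)) -degN.
have -> : toM e = [multinom (e i : nat) | i < n] :> 'X_{1..n} by exact: insubdK.
by rewrite mnmE inord_val.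
Qed.

End PowerSeriesProduct.

Lemma lrmorph_mpoly_eq (R : comNzRingType) k (A : comAlgType R)
    (phi phi' : {lrmorphism {mpoly R[k]} -> A}) :
  (forall i, phi 'X_i = phi' 'X_i) -> phi =1 phi'.
Proof.
move=> eqX p; rewrite (mpolyE p) !linear_sum; apply: eq_bigr => m _.
rewrite !linearZ (mpolyXE _ 1) !rmorph_prod; congr (_ *: _); apply: eq_bigr => i _.
by rewrite !rmorphXn /= eqX.
Qed.

(** * Signed permutations acting on the two sets of variables *)

Section SignedAction.
Context {n : nat} {R : comNzRingType}.
Implicit Types (g h : signed_perm n) (U V : 'I_n -> {mpoly R[n + n]}).

HB.instance Definition _ U V := GRing.LRMorphism.copy (uvsubst U V)
  (comp_mpoly [tuple match split k with inl i => U i | inr i => V i end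
              | k < n + n]).
HB.instance Definition _ g := GRing.LRMorphism.copy (@uact n R g) (uvsubst _ _).
HB.instance Definition _ g := GRing.LRMorphism.copy (@vact n R g) (uvsubst _ _).

Lemma uvsubst_u U V i : uvsubst U V (uvar R i) = U i.
Proof.
rewrite /uvsubst /uvar comp_mpolyXU -tnth_nth tnth_mktuple.
by rewrite -[lshift n i]/(unsplit (inl i)) unsplitK.
Qed.

Lemma uvsubst_v U V i : uvsubst U V (vvar R i) = V i.
Proof.
rewrite /uvsubst /vvar comp_mpolyXU -tnth_nth tnth_mktuple.
by rewrite -[rshift n i]/(unsplit (inr i)) unsplitK.
Qed.

Lemma lrmorph_uv_eq (A : comAlgType R)
    (phi phi' : {lrmorphism {mpoly R[n + n]} -> A}) :
  (forall i, phi (uvar R i) = phi' (uvar R i)) ->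
  (forall i, phi (vvar R i) = phi' (vvar R i)) -> phi =1 phi'.
Proof.
move=> eqU eqV; apply: lrmorph_mpoly_eq => k.
by rewrite -(splitK k); case: (split k) => i; [apply: eqU | apply: eqV].
Qed.

Lemma uactM g h p : uact (g * h)%g p = uact g (uact h p) :> {mpoly R[n + n]}.
Proof.
apply: (lrmorph_uv_eq _ (uact (g * h)%g) (uact g \o uact h)) => i /=;
  rewrite /uact !(uvsubst_u, uvsubst_v) //.
rewrite linearZ /= uvsubst_u scalerA -signr_addb ffunE !permM (permK (sp_perm g)).
by rewrite addbC.
Qed.

Lemma uact_vmonom g m : uact g (vmonom R m) = vmonom R m.
Proof.
by rewrite rmorph_prod; apply: eq_bigr => i _; rewrite rmorphXn /= /uact uvsubst_v.
Qed.

Lemma vact_umonom g m : vact g (umonom R m) = umonom R m.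
Proof.
by rewrite rmorph_prod; apply: eq_bigr => i _; rewrite rmorphXn /= /vact uvsubst_u.
Qed.

Lemma uact_vact g h p : uact g (vact h p) = vact h (uact g p) :> {mpoly R[n + n]}.
Proof.
apply: (lrmorph_uv_eq _ (uact g \o vact h) (vact h \o uact g)) => i;
  by rewrite /= /uact /vact !(uvsubst_u, uvsubst_v) !linearZ /= !(uvsubst_u, uvsubst_v).
Qed.

(** Both sides are the same sign times u_(sigma i) v_i: the inverse of g carries v_(sigma i) back to
    v_i with the sign that g puts on u_(sigma i). *)
Lemma uact_uv g i :
  uact g (uvar R i * vvar R i) =
  vact g^-1%g (uvar R (sp_perm g i) * vvar R (sp_perm g i)).
Proof.
rewrite !rmorphM /= /uact /vact !(uvsubst_u, uvsubst_v).
rewrite -[sp_perm g^-1%g]/((sp_perm g)^-1%g) (permK (sp_perm g)).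
rewrite -[sp_sgn g^-1%g]/[ffun j => sp_sgn g (sp_perm g j)] ffunE.
by rewrite -scalerAl -scalerAr.
Qed.

End SignedAction.

(** * The operators E_chi on the product and on monomials *)

Section Operators.
Context {K : realType} {n : nat} {G : {group signed_perm n}}.
Context {a : Irr K G -> K[i]} {R : comAlgType (Rpsi a)}.
Implicit Types (phi : signed_perm n -> K[i]) (p q : {mpoly R[n + n]}).
Implicit Types (f : fps R) (x : Irr K G).
Local Notation S := (subring_gen (Rpsi_gen a)).

(** The morphisms agree on the factors up to the permutation s, which does not affect a commutative
    product. Truncation turns coefficientwise action into a ring morphism of polynomials in t. *)
Lemma lrmorph_fprod (phi phi' : {lrmorphism {mpoly R[n + n]} -> {mpoly R[n + n]}})
    (s : 'S_n) f N :
  (forall i, phi (uvar R i * vvar R i) = phi' (uvar R (s i) * vvar R (s i))) ->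
  phi (fprod_tuv f N) = phi' (fprod_tuv f N).
Proof.
move=> eq_uv; rewrite /fprod_tuv coef_fps_prod -!coef_map !rmorph_prod.
congr ((polyseq _)`_N); rewrite [RHS](reindex_inj (@perm_inj _ s)).
apply: eq_bigr => i _; apply/polyP => k; rewrite !coef_map !coef_poly.
case: ifP => _ /=; last by rewrite !rmorph0.
by rewrite /fps_eval_t !linearZ !rmorphXn /= eq_uv.
Qed.

Lemma uact_fprod f g N :
  uact g (fprod_tuv f N) = vact g^-1%g (fprod_tuv f N).
Proof.
exact: (lrmorph_fprod (uact g) (vact g^-1%g) (sp_perm g) f N (uact_uv g)).
Qed.

Lemma coef_fprod f N :
  fprod_tuv f N = fps_msum (fun m : 'X_{1..n} =>
    (\prod_(i < n) f (m i)) *: (umonom R m * vmonom R m)) N.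
Proof.
rewrite /fprod_tuv fps_prod_msum; apply: eq_bigr => m _.
rewrite scaler_prod /umonom /vmonom -big_split; congr (_ *: _).
by apply: eq_bigr => i _; rewrite exprMn.
Qed.

Lemma Eu_linear phi : linear (@Eu K n G a R phi).
Proof.
move=> c p q; rewrite /Eu /Eop scalerA mulrC -scalerA -scalerDr; congr (_ *: _).
rewrite scaler_sumr -big_split; apply: eq_bigr => g _ /=.
by rewrite linearP scalerDr !scalerA mulrC.
Qed.

HB.instance Definition _ phi :=
  GRing.isLinear.Build R {mpoly R[n + n]} {mpoly R[n + n]} *:%R
    (@Eu K n G a R phi) (Eu_linear phi).

Lemma Ev_linear phi : linear (@Ev K n G a R phi).
Proof.
move=> c p q; rewrite /Ev /Eop scalerA mulrC -scalerA -scalerDr; congr (_ *: _).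
rewrite scaler_sumr -big_split; apply: eq_bigr => g _ /=.
by rewrite linearP scalerDr !scalerA mulrC.
Qed.

HB.instance Definition _ phi :=
  GRing.isLinear.Build R {mpoly R[n + n]} {mpoly R[n + n]} *:%R
    (@Ev K n G a R phi) (Ev_linear phi).

Lemma Eu_mulr_fixed phi p q :
  (forall g, uact g q = q) -> Eu phi (p * q) = Eu phi p * q.
Proof.
move=> fix_q; rewrite /Eu /Eop -scalerAl mulr_suml; congr (_ *: _).
by apply: eq_bigr => g _; rewrite rmorphM /= fix_q scalerAl.
Qed.

Lemma Ev_mull_fixed phi p q :
  (forall g, vact g p = p) -> Ev phi (p * q) = p * Ev phi q.
Proof.
move=> fix_p; rewrite /Ev /Eop -scalerAr mulr_sumr; congr (_ *: _).
by apply: eq_bigr => g _; rewrite rmorphM /= fix_p scalerAr.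
Qed.

Lemma uact_Ev phi g p : uact g (Ev phi p) = Ev phi (uact g p).
Proof.
rewrite /Ev /Eop linearZ linear_sum /=; congr (_ *: _).
by apply: eq_bigr => h _; rewrite linearZ /= uact_vact.
Qed.

Lemma Eu_Ev_sum phi phi' (I : Type) (r : seq I) (P : pred I) (c : I -> R)
    (F : I -> {mpoly R[n + n]}) :
  Eu phi (Ev phi' (\sum_(i <- r | P i) c i *: F i)) =
  \sum_(i <- r | P i) c i *: Eu phi (Ev phi' (F i)).
Proof. exact: (linear_comb (Eu phi \o Ev phi')). Qed.

(** [Ev] of a v-monomial is still fixed by the u-action, since the two actions commute. *)
Lemma Eu_Ev_monom phi phi' m :
  Eu phi (Ev phi' (umonom R m * vmonom R m)) =
  Eu phi (umonom R m) * Ev phi' (vmonom R m).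
Proof.
rewrite Ev_mull_fixed => [|g]; last exact: vact_umonom.
by apply: Eu_mulr_fixed => g; rewrite uact_Ev uact_vmonom.
Qed.

Lemma Eu_fprod f N x :
  Eu (irr_chi x) (fprod_tuv f N) = Ev (conj_char (irr_chi x)) (fprod_tuv f N).
Proof.
(* The prefactors chi(1) must agree as well; the identity is its own inverse. *)
have chi1 : conj_char (irr_chi x) 1%g = irr_chi x 1%g.
  by rewrite -(irr_chi_inv x (group1 G)) invg1.
rewrite /Eu /Ev /Eop chi1; apply: (congr1 (GRing.scale _)).
rewrite [LHS](reindex_inj invg_inj); apply: eq_big => g; first by rewrite groupV.
by rewrite groupV => Gg; rewrite -(irr_chi_inv x Gg) uact_fprod invgK.
Qed.

(** [to_Rpsi] is the identity on [S] but a default value elsewhere, hence the membership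
    conditions. *)
Lemma to_algM {y z} : y \in S -> z \in S -> to_alg R (y * z) = to_alg R y * to_alg R z.
Proof.
move=> Sy Sz; rewrite /to_alg -[RHS](rmorphM (in_alg R)); congr (_%:A); apply: val_inj.
by rewrite rmorphM /= !to_RpsiK ?rpredM.
Qed.

Lemma to_alg_sum (I : Type) (r : seq I) (P : pred I) (F : I -> K[i]) :
  (forall i, P i -> F i \in S) ->
  to_alg R (\sum_(i <- r | P i) F i) = \sum_(i <- r | P i) to_alg R (F i).
Proof.
move=> SF; rewrite /to_alg -[RHS](rmorph_sum (in_alg R)); congr (_%:A); apply: val_inj.
rewrite rmorph_sum /= to_RpsiK ?rpred_sum //.
by apply: eq_bigr => i Pi; rewrite to_RpsiK ?SF.
Qed.

Lemma to_alg_nat k : to_alg R k%:R = k%:R.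
Proof.
rewrite /to_alg -[RHS](rmorph_nat (in_alg R)); congr (_%:A); apply: val_inj.
by rewrite rmorph_nat /= to_RpsiK ?rpred_nat.
Qed.

Lemma irr_chi_conv x k : k \in G ->
  irr_chi x 1%g * (\sum_(g in G) irr_chi x g * irr_chi x (k * g^-1)%g) =
  #|G|%:R * irr_chi x k.
Proof.
move=> Gk; rewrite {1}/irr_chi repr_mx1 mxtrace1.
exact: (trace_repr_conv (socle_irr x)).
Qed.

Lemma Eu_Eu x p : a x != 0 ->
  Eu (irr_chi x) (Eu (irr_chi x) p) = #|G|%:R *: Eu (irr_chi x) p :> {mpoly R[n + n]}.
Proof.
(* The nonvanishing of [a x] puts the values of chi in R_psi, so the convolution identity can be
   transported to R. *)
move=> ax; have S_chi := mem_Rpsi_char ax; apply: group_sum_idem => [|k Gk].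
  exact: uactM.
rewrite -to_alg_nat -[RHS]to_algM ?rpred_nat ?S_chi // -irr_chi_conv //.
have S_conv g : g \in G -> irr_chi x g * irr_chi x (k * g^-1)%g \in S.
  by move=> Gg; rewrite rpredM ?S_chi ?groupM ?groupV.
rewrite [RHS](to_algM (S_chi _ (group1 G)) (rpred_sum _ S_conv)).
rewrite (to_alg_sum _ _ _ _ S_conv); apply: (congr1 (GRing.mul _)).
apply: eq_bigr => g Gg; have Gkg : (k * g^-1)%g \in G by rewrite groupM ?groupV.
by rewrite (to_algM (S_chi _ Gg) (S_chi _ Gkg)).
Qed.

End Operators.

Theorem corollary2p3 (K : realType) (n : nat) (n_gt0 : (0 < n)%N)
    (G : {group signed_perm n})
    (psi : signed_perm n -> K[i])
    (psi_class : {in G &, forall g h, psi (g ^ h)%g = psi g})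
    (a : Irr K G -> K[i])
    (psiE : {in G, forall g, psi g = \sum_(x : Irr K G) a x * irr_chi x g})
    (R : comAlgType (Rpsi a)) (f : fps R) :
  fps_map (fun p => #|G|%:R *: Eu_psi p) (fprod_tuv f) =
    fps_map (fun p => #|G|%:R *: Ev_psibar p) (fprod_tuv f) /\
  fps_map (fun p => #|G|%:R *: Ev_psibar p) (fprod_tuv f) =
    (fun N => \sum_(x : Irr K G | a x != 0) to_alg R (a x) *:
       fps_msum (fun m : 'X_{1..n} =>
         (\prod_(i < n) f (m i)) *:
           (Eu (irr_chi x) (umonom R m) *
            Ev (conj_char (irr_chi x)) (vmonom R m))) N).
Proof.
split; apply/funext => N; rewrite /fps_map.
  apply: (congr1 (GRing.scale _)); apply: eq_bigr => x _.
  by rewrite Eu_fprod.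
rewrite /Ev_psibar scaler_sumr; apply: eq_bigr => x ax.
rewrite scalerA mulrC -scalerA; apply: (congr1 (GRing.scale _)).
(* Return to the u's, spend |G| on a second copy of E_chi, and trade only the inner copy for the
   v-action. *)
rewrite -Eu_fprod -Eu_Eu // Eu_fprod coef_fprod Eu_Ev_sum.
by apply: eq_bigr => m _; rewrite Eu_Ev_monom.
Qed.
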